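(* Let $L$ be a $2$-dimensional Lorentzian lattice, with $S$, $\Omega$, the order on $S$, oriented bases and $M$-supplements as in the context. Let $M>0$, let $r\in S-\Omega$ be a primitive lattice vector, and let $l$ be an $M$-supplement of $r$. Suppose also that $S$ contains a primitive lattice vector of norm $\leq M$ that comes after $r$. Then the following recursive algorithm $\mathsf{Promised}(M,r,l)$ terminates and returns a pair $(r',l')$, where $r'$ is the first such vector and $l'$ is an $M$-supplement of $r'$. 1. Set $m\leftarrow r+l$. 2. If $m^2\leq M$ or $m\cdot r<0$, then return $\mathsf{Promised}(M,r,m)$. 3. If $l^2\geq0$ and $r\cdot l>0$, then return $(l,-r)$. 4. Return $\mathsf{Promised}(M,m,l)$.
   Context: A Lorentzian lattice of dimension $2$ is a free abelian group $L$ of rank $2$ with a $\mathbb{Q}$-valued symmetric bilinear form $v\cdot w$ of signature $(1,1)$; $v^2=v\cdot v$ is the norm. A vector is primitive if it generates a direct summand of $L$. Let $P=L\otimes\mathbb{R}$. Spacelike means positive norm; lightlike means nonzero of norm $0$. The set of nonzero vectors of $P$ of nonnegative norm has two components; $S$ is one of them (a closed sector minus the origin, including both of its bounding lightlike rays). Fix an orientation of the plane $P$. For nonproportional $v,w\in S$, $v$ precedes $w$ (and $w$ comes after $v$) if the ordered basis $(v,w)$ of $P$ represents the orientation. This is a partial order on $S$, which is total on the set of primitive lattice vectors in $S$. $\Omega$ is the set of lightlike vectors on the bounding ray of $S$ which comes after all other rays of $S$. An oriented basis is a basis of $L$ (over $\mathbb{Z}$) representing the chosen orientation of $P$. For $M>0$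 and a primitive lattice vector $r\in S$, an element $l\in L$ is an $M$-supplement of $r$ if (i) $(r,l)$ is an oriented basis, and (ii) $l$ does not lie in the interior of the convex hull of the norm $M$ hyperbola in $S$, i.e. it is not the case that both $l\in S$ and $l^2>M$. *)

(* Defs.v *)
(* Mathematical Components and MathComp-Analysis. *)
From HB Require Import structures.
From mathcomp Require Import all_boot all_order all_algebra.
From mathcomp Require Import all_classical all_reals.
From mathcomp Require Import topology normedtype.

Set Implicit Arguments.
Unset Strict Implicit.
Unset Printing Implicit Defensive.

Import Order.TTheory GRing.Theory Num.Theory.
Import numFieldNormedType.Exports.

Local Open Scope classical_set_scope.
Local Open Scope ring_scope.

Definition is_zbasis (L : zmodType) (b1 b2 : L) : Prop :=
  forall v : L, exists! c : int * int, v = b1 *~ c.1 + b2 *~ c.2.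

Definition is_rbasis (R : realType) (P : lmodType R) (e1 e2 : P) : Prop :=
  forall v : P, exists! c : R * R, v = c.1 *: e1 + c.2 *: e2.

(* The universal property of the extension of scalars L -> L \otimes_Z R. *)
Definition is_scalar_extension (R : realType) (L : zmodType) (P : lmodType R)
    (emb : {additive L -> P}) : Prop :=
  forall (V : lmodType R) (f : {additive L -> V}),
  exists2 g : {linear P -> V}, (forall x, g (emb x) = f x) &
    forall h : {linear P -> V}, (forall x, h (emb x) = f x) -> g =1 h.

(* A Lorentzian lattice of dimension 2, together with a model [plane] of its
   real extension, to which the form is extended as [rdot].  The norm of the
   normed space [plane] is arbitrary: it only provides the usual topology of a
   finite dimensional real vector space, and is unrelated to the form. *)
Record lorentzianLattice (R : realType) := LorentzianLattice {
  lat :> zmodType;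
  dot : lat -> lat -> rat;
  plane : normedModType R;
  emb : {additive lat -> plane};
  rdot : plane -> plane -> R;
  lat_rank2 : exists b1 b2 : lat, is_zbasis b1 b2;
  dotC : forall v w, dot v w = dot w v;
  dotDl : forall u v w, dot (u + v) w = dot u w + dot v w;
  plane_extension : is_scalar_extension emb;
  rdotC : forall p q, rdot p q = rdot q p;
  rdotPl : forall (a : R) p q s, rdot (a *: p + q) s = a * rdot p s + rdot q s;
  rdot_emb : forall v w, rdot (emb v) (emb w) = ratr (dot v w);
  (* signature (1,1) *)
  rdot_signature : exists e f : plane,
    [/\ is_rbasis e f, rdot e f = 0, 0 < rdot e e & rdot f f < 0]
}.

Arguments dot {R l} v w.
Arguments plane {R} l.
Arguments emb {R l}.
Arguments rdot {R l} p q.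

Section LorentzianPlane.
Variables (R : realType) (L : lorentzianLattice R).

Definition lightlike (p : plane L) : Prop := p != 0 /\ rdot p p = 0.

Definition nonneg_vectors : set (plane L) := [set p | p != 0 /\ 0 <= rdot p p].

Definition is_nonneg_component (S : set (plane L)) : Prop :=
  exists2 p, nonneg_vectors p & S = connected_component nonneg_vectors p.

(* The ordered basis b' is obtained from the ordered basis b by a change of
   basis of positive determinant. *)
Definition same_orientation (b b' : plane L * plane L) : Prop :=
  exists a11 a12 a21 a22 : R,
    [/\ b'.1 = a11 *: b.1 + a12 *: b.2,
        b'.2 = a21 *: b.1 + a22 *: b.2 &
        0 < a11 * a22 - a12 * a21].

(* An orientation is a class of ordered bases; (p, q) represents the
   orientation O when O (p, q). *)
Definition is_orientation (O : set (plane L * plane L)) : Prop :=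
  exists2 b : plane L * plane L, is_rbasis b.1 b.2 &
    O = [set b' | same_orientation b b'].

Variables (S : set (plane L)) (O : set (plane L * plane L)).

(* Members of O are bases, so p and q are nonproportional here. *)
Definition precedes (p q : plane L) : Prop := [/\ S p, S q & O (p, q)].

Definition same_ray (p q : plane L) : Prop := exists2 a : R, 0 < a & q = a *: p.

Definition Omega : set (plane L) :=
  [set p | [/\ S p, lightlike p & forall q, S q -> ~ same_ray p q -> precedes q p]].

Definition primitive (v : L) : Prop :=
  exists K : set L,
    [/\ K 0, (forall x y, K x -> K y -> K (x - y)),
        (forall x, exists n : int, exists2 k, K k & x = v *~ n + k) &
        (forall n : int, K (v *~ n) -> v *~ n = 0)].

Definition oriented_basis (v w : L) : Prop := is_zbasis v w /\ O (emb v, emb w).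

Variable M : R.

Definition supplement (r l : L) : Prop :=
  oriented_basis r l /\ ~ (S (emb l) /\ M < ratr (dot l l)).

(* The primitive lattice vectors of S of norm at most M that come after r. *)
Definition later_short (r v : L) : Prop :=
  [/\ primitive v, S (emb v), ratr (dot v v) <= M & precedes (emb r) (emb v)].

Definition first_later_short (r r' : L) : Prop :=
  later_short r r' /\
  forall v, later_short r v -> v = r' \/ precedes (emb r') (emb v).

End LorentzianPlane.

(* The recursive algorithm, with [fuel] bounding the number of calls: it
   terminates on (r, l) with result x iff [promised M fuel r l = Some x] for
   some [fuel], and x does not depend on the choice of such a [fuel]. *)
Fixpoint promised (R : realType) (L : lorentzianLattice R) (M : R) (fuel : nat)
    (r l : L) : option (L * L) :=
  if fuel is fuel'.+1 then
    let m := r + l in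
    if (ratr (dot m m) <= M) || (dot m r < 0) then promised M fuel' r m
    else if (0 <= dot l l) && (0 < dot r l) then Some (l, - r)
    else promised M fuel' m l
  else None.

(* Main.v *)
Require Import Defs.
From HB Require Import structures.
From mathcomp Require Import all_boot all_order all_algebra.
From mathcomp Require Import all_classical all_reals.
From mathcomp Require Import topology normedtype.
From mathcomp Require Import derive ring lra zify.
Import Order.TTheory GRing.Theory Num.Theory.
Import numFieldNormedType.Exports.
Local Open Scope classical_set_scope.
Local Open Scope ring_scope.

(** The proof takes place in light-cone coordinates.  The signature provides
null vectors u and w spanning the plane with u.w = 2; writing a and b for the
coordinates p.u and p.w, the form becomes p.q = (a(p) b(q) + b(p) a(q)) / 2.
The vectors of nonnegative norm then fill two opposite closed quadrants without
the origin, so that after a change of signs S is the quadrant a, b >= 0, and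
after an exchange of u and w the orientation is given by the sign of
area(p, q) = a(p) b(q) - b(p) a(q) ([null_coordinates_exist]).  Everything
afterwards is arithmetic in these coordinates.

Correctness.  Write m = r + l.  When step 2 does not apply, m is in the
interior of S and has norm > M ([sum_spacelike]).  Adding vectors of the closed
quadrant to m does not decrease a or b, hence not the norm a b
([norm_add_combination]), so no lattice vector of norm <= M lies in
m + (the cone of S).  If moreover l is in S, every lattice vector strictly
between r and l is of this kind, and l itself is short by definition of a
supplement, so l is the first short vector after r
([first_later_short_supplement]).  If l is not in S, the vectors after r and up
to the ray of m are of this kind, and one may replace r by m
([later_short_sum], [first_later_short_sum]).

Termination.  Fix a short vector v = r x + l y after r, so that y > 0.
Step 2 keeps y, and step 4 replaces (x, y) by (x, y - x), where x > 0 because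
otherwise l would be in S ([later_short_coef_gt0]).  So it is enough that step 2
is not repeated forever with the same r: r does not lie on the last ray of S, so
a(r) > 0; hence a(l + k r) tends to infinity with k, while the identity
a(r) b(m) = b(r) a(m) + area(r, l) keeps b(l + k r) away from 0, and the norm
of l + k r tends to infinity ([step_bound]). *)

(** * Light-cone coordinates *)

(** Outside a large segment the triangle inequality bounds the distance from
below, and on the segment the distance attains a minimum. *)
Lemma dist_to_line_gt0 (R : realType) (V : normedModType R) (e f : V) :
  (forall t : R, e != t *: f) ->
  exists2 d : R, 0 < d & forall t : R, d <= `|e - t *: f|.
Proof.
move=> nef; have [f0|f0] := eqVneq f 0.
  exists `|e| => [|t]; last by rewrite f0 scaler0 subr0.
  by rewrite normr_gt0; have := nef 0; rewrite scale0r.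
have nf : 0 < `|f| by rewrite normr_gt0.
have ne : 0 < `|e| by rewrite normr_gt0; have := nef 0; rewrite scale0r.
(* For `|t| > T one has `|t *: f| > 2 `|e|, so the distance exceeds `|e|. *)
pose T := 2 * `|e| / `|f|; have T0 : 0 <= T by rewrite /T divr_ge0 ?mulr_ge0 ?ltW.
pose g (t : R) : R := `|e - t *: f|.
have gc : continuous g.
  move=> t; apply: cvg_norm; apply: cvgB; first exact: cvg_cst.
  exact: scalel_continuous.
have [c _ cmin] : exists2 c, c \in `[- T, T] & forall t, t \in `[- T, T] -> g c <= g t.
  by apply: EVT_min; [lra | exact: continuous_subspaceT].
exists (Num.min (g c) `|e|) => [|t].
  by rewrite lt_min ne andbT normr_gt0 subr_eq0 nef.
have [tT|tT] := boolP (t \in `[- T, T]); first by rewrite ge_min cmin.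
rewrite ge_min; apply/orP; right.
have Tt : T < `|t|.
  move: tT; rewrite in_itv /= -ler_norml -ltNge; done.
have h : 2 * `|e| < `|t *: f|.
  by rewrite normrZ -ltr_pdivrMr.
have := lerB_dist (t *: f) e; rewrite distrC; lra.
Qed.

Lemma scale_sum_diff (R : pzRingType) (V : lmodType R) (a b : R) (p q : V) :
  a *: (p + q) + b *: (p - q) = (a + b) *: p + (a - b) *: q.
Proof. by rewrite scalerBr scalerDr addrACA -scalerDl -scalerBl. Qed.

Section Dot.
Set Implicit Arguments.
Unset Strict Implicit.
Variables (R : realType) (L : lorentzianLattice R).
Implicit Types p q s : plane L.

Lemma rdotDl p q s : rdot (p + q) s = rdot p s + rdot q s.
Proof. by rewrite -{1}[p]scale1r rdotPl mul1r. Qed.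

Lemma rdot0l s : rdot 0 s = 0.
Proof. by have := rdotDl 0 0 s; rewrite addr0; lra. Qed.

Lemma rdotZl (a : R) p s : rdot (a *: p) s = a * rdot p s.
Proof. by rewrite -[a *: p]addr0 rdotPl rdot0l addr0. Qed.

Lemma rdotNl p s : rdot (- p) s = - rdot p s.
Proof. by rewrite -scaleN1r rdotZl mulN1r. Qed.

Lemma rdotDr p q s : rdot s (p + q) = rdot s p + rdot s q.
Proof. by rewrite rdotC rdotDl ![rdot _ s]rdotC. Qed.

Lemma rdotNr p s : rdot s (- p) = - rdot s p.
Proof. by rewrite rdotC rdotNl rdotC. Qed.

Lemma rdotZr (a : R) p s : rdot s (a *: p) = a * rdot s p.
Proof. by rewrite rdotC rdotZl rdotC. Qed.

Definition rdotE := (rdotDl, rdotDr, rdotNl, rdotNr, rdotZl, rdotZr).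

Definition null_basis (u w : plane L) : Prop :=
  [/\ rdot u u = 0, rdot w w = 0, rdot u w = 2 &
      forall p, p = (rdot p w / 2) *: u + (rdot p u / 2) *: w].

Lemma null_basis_sym u w : null_basis u w -> null_basis w u.
Proof. move=> [uu ww uw pE]; split=> [| | |p] //; first by rewrite rdotC.
by rewrite addrC.
Qed.

Lemma null_basis_opp u w : null_basis u w -> null_basis (- u) (- w).
Proof.
move=> [uu ww uw pE]; split=> [| | |p]; rewrite ?rdotE ?opprK ?uu ?ww ?oppr0 //.
by rewrite !mulNr !scaleNr !scalerN !opprK.
Qed.

(** Normalizing the orthogonal basis of the signature to vectors of norms 1 and
-1, one takes their sum and their difference. *)
Lemma null_basis_exists : exists u w, null_basis u w.
Proof.
have [e [f [bef ef ee ff]]] := @rdot_signature R L.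
pose s := Num.sqrt (rdot e e); pose t := Num.sqrt (- rdot f f).
have s0 : 0 < s by rewrite sqrtr_gt0.
have t0 : 0 < t by rewrite sqrtr_gt0 oppr_gt0.
have s2 : rdot e e = s ^+ 2 by rewrite sqr_sqrtr // ltW.
have t2 : rdot f f = - t ^+ 2 by rewrite sqr_sqrtr ?opprK // oppr_ge0 ltW.
have fe : rdot f e = 0 by rewrite rdotC.
exists (s^-1 *: e + t^-1 *: f), (s^-1 *: e - t^-1 *: f).
split; [| | |move=> p]; rewrite ?rdotE ?ef ?fe ?s2 ?t2.
- by field; rewrite !gt_eqF.
- by field; rewrite !gt_eqF.
- by field; rewrite !gt_eqF.
have [[x y] [/= -> _]] := bef p.
rewrite ?rdotE ?ef ?fe ?s2 ?t2 scale_sum_diff !scalerA.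
by congr (_ *: _ + _ *: _); field; rewrite !gt_eqF.
Qed.

Section NullBasis.
Variables (u w : plane L).
Hypothesis uwP : null_basis u w.

Lemma null_basis_dot p q :
  rdot p q = (rdot p u * rdot q w + rdot p w * rdot q u) / 2.
Proof.
case: uwP => _ _ _ pE; rewrite {1}(pE p) rdotE ![rdot _ q]rdotC.
by rewrite !rdotE; field.
Qed.

Lemma null_basis_eq0 p : rdot p u = 0 -> rdot p w = 0 -> p = 0.
Proof.
case: uwP => _ _ _ pE pu pw.
by rewrite (pE p) pu pw mul0r !scale0r addr0.
Qed.

(** The kernel of this functional is the line of u - w, so up to a factor its
value at p is the coordinate of p along u + w; the distance from u + w to that
line bounds it by a multiple of the norm of p, whatever the norm is. *)
Lemma null_sum_continuous : continuous (fun p => rdot p (u + w)).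
Proof.
case: uwP => uu ww uw pE; have wu : rdot w u = 2 by rewrite rdotC.
have [t|d d0 dP] := @dist_to_line_gt0 R (plane L) (u + w) (u - w).
  apply/negP => /eqP /(congr1 (rdot^~ (u + w))).
  by rewrite !rdotE uu ww uw wu => h; lra.
have bnd p : `|rdot p (u + w)| * d <= 4 * `|p|.
  set c := rdot p (u + w); have [->|c0] := eqVneq c 0.
    by rewrite normr0 mul0r mulr_ge0.
  have pcE : p = (c / 4) *: (u + w - ((rdot p u - rdot p w) / c) *: (u - w)).
    rewrite scalerBr scalerA -scaleNr scale_sum_diff {1}(pE p).
    by congr (_ *: _ + _ *: _); rewrite /c rdotDr in c0 *; field.
  have q4 : (0 : R) <= 4^-1 by rewrite invr_ge0.
  rewrite [in leRHS]pcE normrZ normrM (ger0_norm q4).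
  set z := (_ / c) *: _.
  have := ler_wpM2l (normr_ge0 c) (dP ((rdot p u - rdot p w) / c)).
  rewrite -/z; lra.
move=> p; apply/cvgrPdist_lt => eps eps0; near=> q.
have e0 : `|p - q| < eps * d / 4.
  by near: q; apply: cvgr_dist_lt => //; rewrite divr_gt0 ?mulr_gt0.
have := bnd (p - q); rewrite rdotDl rdotNl -(ltr_pM2r d0); lra.
Unshelve. all: by end_near.
Qed.

Definition quadrant : set (plane L) :=
  [set p | [/\ 0 <= rdot p u, 0 <= rdot p w & 0 < rdot p u + rdot p w]].

Lemma quadrantP p :
  @nonneg_vectors R L p -> 0 < rdot p u + rdot p w -> quadrant p.
Proof.
move=> [_]; rewrite null_basis_dot => h s0; split=> //; nra.
Qed.

(** A vector of nonnegative norm with a = - b is zero, so the continuous function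
a + b has no zero on the component and keeps its sign there; conversely the
quadrant is convex. *)
Lemma connected_component_quadrant p0 : 
  @nonneg_vectors R L p0 -> 0 < rdot p0 u + rdot p0 w ->
  connected_component (@nonneg_vectors R L) p0 = quadrant.
Proof.
move=> Np0 p0uw; have [_ p0p0] := Np0.
have Qp0 := quadrantP Np0 p0uw.
apply/seteqP; split=> p.
  move=> Cp; have Np := connected_component_sub Cp.
  apply: quadrantP => //; rewrite ltNge; apply/negP => puw.
  have /connected_intervalP : connected ((fun p => rdot p (u + w)) @`
      connected_component (@nonneg_vectors R L) p0).
    apply: connected_continuous_connected; first exact: component_connected.
    exact: continuous_subspaceT null_sum_continuous.
  move=> itv; have [| | |q] := itv (rdot p (u + w)) (rdot p0 (u + w)) _ _ 0.
  - by exists p.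
  - by exists p0 => //; exact: connected_component_refl.
  - by rewrite !rdotDr puw ltW.
  move=> /connected_component_sub [q0 +]; rewrite rdotDr null_basis_dot => qq qs.
  by case/eqP: q0; apply: null_basis_eq0; nra.
move=> [pu pw ps]; case: Qp0 => p0u p0w _.
pose g (t : R) := p0 + t *: (p - p0).
apply: (@connected_component_max _ _ (g @` `[0, 1])).
- exists 0; first by rewrite /= in_itv /= lexx ler01.
  by rewrite /g scale0r addr0.
- move=> _ [t /= + <-]; rewrite in_itv /= => /andP[t0 t1].
  have gu : 0 <= rdot (g t) u by rewrite /g !rdotE; nra.
  have gw : 0 <= rdot (g t) w by rewrite /g !rdotE; nra.
  split; last by rewrite null_basis_dot; nra.
  apply/eqP => /(congr1 (rdot^~ (u + w))); rewrite rdot0l /g !rdotE => h.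
  by have [AB|BA] := leP (rdot p u + rdot p w) (rdot p0 u + rdot p0 w); nra.
- apply: connected_continuous_connected; first exact: segment_connected.
  apply: continuous_subspaceT => t; apply: cvgD; first exact: cvg_cst.
  exact: scalel_continuous.
- exists 1; first by rewrite /= in_itv /= lexx ler01.
  by rewrite /g scale1r addrC subrK.
Qed.


End NullBasis.

Definition null_coordinates (S : set (plane L)) (O : set (plane L * plane L))
    (u w : plane L) : Prop :=
  [/\ null_basis u w, forall p, S p <-> quadrant u w p &
      forall p q, O (p, q) <->
        0 < rdot p u * rdot q w - rdot p w * rdot q u].

Lemma nonneg_component_quadrant S : is_nonneg_component S ->
  exists u w, null_basis u w /\ S = quadrant u w.
Proof.
have [u [w uwP]] := null_basis_exists.
move=> [p Np ->]; have [p0 pp] := Np; rewrite (null_basis_dot uwP) in pp.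
have [ps|ps] := ltP 0 (rdot p u + rdot p w).
  by exists u, w; split=> //; exact: connected_component_quadrant.
exists (- u), (- w); have uwN := null_basis_opp uwP; split=> //.
apply: connected_component_quadrant => //; rewrite !rdotE -opprD oppr_gt0.
rewrite lt_neqAle ps andbT; apply/eqP => ps0.
by case/eqP: p0; apply: (null_basis_eq0 uwP); nra.
Qed.

(** The area form is multiplied by the determinant under a change of basis, and
its value on the basis that defines the orientation is nonzero, of a sign that
tells the two cases apart. *)
Lemma orientation_null_basis u w O : null_basis u w -> is_orientation O ->
  (forall p q, O (p, q) <-> 0 < rdot p u * rdot q w - rdot p w * rdot q u) \/
  (forall p q, O (p, q) <-> 0 < rdot p w * rdot q u - rdot p u * rdot q w).
Proof.
move=> uwP [[b1 b2] /= bP ->].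
have [uu ww uw _] := uwP.
pose D := rdot b1 u * rdot b2 w - rdot b1 w * rdot b2 u.
(* Expanding u and w in the basis multiplies D to area(u, w) = - 4. *)
have D0 : D != 0.
  have [[x y] [/= uE _]] := bP u; have [[z t] [/= wE _]] := bP w.
  apply/eqP => D0; have : (x * t - y * z) * D = - 4.
    rewrite (_ : - 4 = rdot u u * rdot w w - rdot u w * rdot w u).
      by rewrite {1 3}uE {1 4}wE !rdotE /D; ring.
    by rewrite uu ww [rdot w u]rdotC uw; ring.
  by rewrite D0 mulr0; lra.
have key p q : same_orientation (b1, b2) (p, q) <->
    0 < (rdot p u * rdot q w - rdot p w * rdot q u) / D.
  split.
    move=> [a11 [a12 [a21 [a22 /= [-> -> a0]]]]].
    rewrite !rdotE (_ : _ / D = a11 * a22 - a12 * a21) //.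
    by rewrite /D in D0 *; field.
  have [[x y] [/= -> _]] := bP p; have [[z t] [/= -> _]] := bP q.
  rewrite !rdotE => h; exists x, y, z, t; split=> //=.
  suff : x * t - y * z = 
     (((x * rdot b1 u + y * rdot b2 u) * (z * rdot b1 w + t * rdot b2 w) -
       (x * rdot b1 w + y * rdot b2 w) * (z * rdot b1 u + t * rdot b2 u)) / D).
    by move=> ->.
  by rewrite /D in D0 *; field.
move: D0; rewrite neq_lt => /orP[D0|D0]; [right|left] => p q;
  apply: (iff_trans (key p q)); last by rewrite pmulr_lgt0 ?invr_gt0.
by rewrite nmulr_lgt0 ?invr_lt0 // -oppr_gt0 opprB addrC.
Qed.

Lemma null_coordinates_exist S O : is_nonneg_component S -> is_orientation O ->
  exists u w, null_coordinates S O u w.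
Proof.
move=> /nonneg_component_quadrant[u [w [uwP ->]]] /(orientation_null_basis uwP).
case=> OE; first by exists u, w.
exists w, u; split=> //; first exact: null_basis_sym.
by move=> p; split=> -[? ? ?]; split=> //; rewrite addrC.
Qed.

End Dot.

(** * Bases of the lattice *)

Section Bases.
Set Implicit Arguments.
Unset Strict Implicit.
Variables (R : realType) (L : lorentzianLattice R).
Implicit Types (r l v : L) (x y : int).

(** The coordinates in the new basis are given by the adjugate matrix. *)
Lemma zbasis_unimodular r l (x y z t : int) :
  is_zbasis r l -> x * t - y * z = 1 ->
  is_zbasis (r *~ x + l *~ y) (r *~ z + l *~ t).
Proof.
move=> bP det1 v.
have comb (c d : int) : (r *~ x + l *~ y) *~ c + (r *~ z + l *~ t) *~ d =
    r *~ (x * c + z * d) + l *~ (y * c + t * d).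
  by rewrite !mulrzDl -!mulrzA addrACA -!mulrzDr.
have [[c d] [/= vE cdP]] := bP v.
exists (t * c - z * d, - y * c + x * d); split=> /= [|[c' d'] /= vE'].
  rewrite comb vE; congr (_ *~ _ + _ *~ _).
    by rewrite -[LHS]mulr1 -det1; ring.
  by rewrite -[LHS]mulr1 -det1; ring.
have [-> ->] := cdP (x * c' + z * d', y * c' + t * d') (etrans vE' (comb _ _)).
congr (_, _).
  by rewrite -[RHS]mulr1 -det1; ring.
by rewrite -[RHS]mulr1 -det1; ring.
Qed.

Lemma zbasis_primitive r l : is_zbasis r l -> primitive r.
Proof.
move=> bP; exists [set v | exists n : int, v = l *~ n]; split.
- by exists 0.
- by move=> _ _ [m ->] [n ->]; exists (m - n); rewrite mulrzBr.
- move=> v; have [[c d] [/= -> _]] := bP v.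
  by exists c, (l *~ d) => //; exists d.
move=> n [m rn].
have [c [_ cP]] := bP (r *~ n).
have c0 : c = (0, m) by apply: cP; rewrite /= add0r.
have cn : c = (n, 0) by apply: cP; rewrite /= addr0.
by move: c0; rewrite cn => -[->].
Qed.

(** Decomposing v itself along the complement of v *~ y shows that
v *~ y *~ (1 - y n) is in the complement for some n, so that y n = 1. *)
Lemma primitive_multiple v y :
  (forall n : int, v *~ n = 0 -> n = 0) -> 0 < y -> primitive (v *~ y) -> y = 1.
Proof.
move=> torsion y0 [K [K0 KB Kdec Kcap]].
have KN k : K k -> K (- k) by move=> Kk; rewrite -sub0r; exact: KB.
have KMn k n : K k -> K (k *+ n).
  by move=> Kk; elim: n => // n IH; rewrite mulrSr -[k in _ + k]opprK; apply/KB/KN.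
have [n [k Kk vE]] := Kdec v.
have kE : (v *~ y) *~ (1 - y * n) = k *~ y.
  rewrite -mulrzA mulrC mulrzA; congr (_ *~ _).
  by rewrite mulrzBr mulr1z mulrzA {1}vE addrC addKr.
have Kky : K (k *~ y) by case: (y) y0 => // m _; exact: KMn.
move: Kky; rewrite -kE => /Kcap; rewrite -mulrzA => /torsion /eqP.
rewrite mulf_eq0 gt_eqF //= subr_eq0 eq_sym => /eqP yn.
have n0 : 0 < n by rewrite -(pmulr_rgt0 _ y0) yn.
have := ler_peMr (ltW y0) (n0 : 1 <= n); lia.
Qed.
End Bases.

(** * The algorithm in coordinates *)

Definition null_coord (R : realType) (L : lorentzianLattice R) (u : plane L)
  (v : L) : R := rdot (emb v) u.

Lemma null_coord_additive (R : realType) (L : lorentzianLattice R)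
  (u : plane L) : zmod_morphism (null_coord u).
Proof. by move=> v v'; rewrite /null_coord raddfB rdotDl rdotNl. Qed.

HB.instance Definition _ (R : realType) (L : lorentzianLattice R)
  (u : plane L) := GRing.isZmodMorphism.Build L R (null_coord u)
    (null_coord_additive u).

Section Algorithm.
Set Implicit Arguments.
Unset Strict Implicit.
Variables (R : realType) (L : lorentzianLattice R).
Variables (S : set (plane L)) (O : set (plane L * plane L)) (u w : plane L).
Hypothesis coords : null_coordinates S O u w.
Variable M : R.
Hypothesis M0 : 0 < M.
Implicit Types (r l v : L) (x y : int).

Local Notation a := (null_coord u).
Local Notation b := (null_coord w).

Definition area v v' : R := a v * b v' - b v * a v'.

Lemma dot_coord v v' : ratr (dot v v') = (a v * b v' + b v * a v') / 2.
Proof. by case: coords => uwP _ _; rewrite -rdot_emb (null_basis_dot uwP). Qed.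

Lemma norm_coord v : ratr (dot v v) = a v * b v.
Proof. by rewrite dot_coord; field. Qed.

Lemma S_coord v : S (emb v) <-> [/\ 0 <= a v, 0 <= b v & 0 < a v + b v].
Proof. by case: coords => _ SP _; exact: SP. Qed.

Lemma O_coord v v' : O (emb v, emb v') <-> 0 < area v v'.
Proof. by case: coords => _ _ OP; exact: OP. Qed.

Lemma areaDr v v' v'' : area v (v' + v'') = area v v' + area v v''.
Proof. by rewrite /area !raddfD /=; ring. Qed.

Lemma areaDl v v' v'' : area (v' + v'') v = area v' v + area v'' v.
Proof. by rewrite /area !raddfD /=; ring. Qed.

Lemma areavv v : area v v = 0.
Proof. by rewrite /area; ring. Qed.

Lemma area_swap v v' : area v v' = - area v' v.
Proof. by rewrite /area; ring. Qed.

Lemma areaMzr v v' x : area v (v' *~ x) = area v v' * x%:~R.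
Proof. by rewrite /area !raddfMz /= -!(mulrzr (null_coord _ _)); ring. Qed.

Lemma area_unimodular r l (x y z t : int) : x * t - y * z = 1 ->
  area (r *~ x + l *~ y) (r *~ z + l *~ t) = area r l.
Proof.
move=> det1; have h : x%:~R * t%:~R - y%:~R * z%:~R = 1 :> R.
  by rewrite -!intrM -intrB det1.
rewrite -[RHS]mul1r -h areaDl !areaDr !areaMzr ![area (_ *~ _) _]area_swap.
by rewrite !areaMzr !areavv (area_swap l r); ring.
Qed.

Lemma oriented_basis_unimodular r l (x y z t : int) :
  oriented_basis O r l -> x * t - y * z = 1 ->
  oriented_basis O (r *~ x + l *~ y) (r *~ z + l *~ t).
Proof.
move=> [bP /O_coord Orl] h; split; first exact: zbasis_unimodular.
by apply/O_coord; rewrite area_unimodular.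
Qed.

Lemma oriented_basis_addr r l : oriented_basis O r l -> oriented_basis O r (r + l).
Proof.
move=> bP; have := @oriented_basis_unimodular r l 1 0 1 1 bP erefl.
by rewrite !mulr1z mulr0z addr0.
Qed.

Lemma oriented_basis_addl r l : oriented_basis O r l -> oriented_basis O (r + l) l.
Proof.
move=> bP; have := @oriented_basis_unimodular r l 1 1 0 1 bP erefl.
by rewrite !mulr1z mulr0z add0r.
Qed.

Lemma oriented_basis_rot r l : oriented_basis O r l -> oriented_basis O l (- r).
Proof.
move=> bP; have := @oriented_basis_unimodular r l 0 1 (-1) 0 bP erefl.
by rewrite mulrNz !mulr1z !mulr0z add0r addr0.
Qed.

(** The norm is the product of the two coordinates, which only grow. *)
Lemma norm_add_combination m p q (i j : int) :
  0 <= a m -> 0 <= b m -> 0 <= a p -> 0 <= b p -> 0 <= a q -> 0 <= b q ->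
  0 <= i -> 0 <= j ->
  M < ratr (dot m m) -> M < ratr (dot (m + (p *~ i + q *~ j)) (m + (p *~ i + q *~ j))).
Proof.
rewrite !norm_coord => am bm ap bp aq bq i0 j0 /lt_le_trans; apply.
by apply: ler_pM => //; rewrite !raddfD !raddfMz /= lerDl addr_ge0 ?mulrz_ge0.
Qed.

(** The identity area(r, v) m = area(m, v) r + area(r, m) v in the plane,
evaluated by a + b, which is positive on S. *)
Lemma precedes_trans r m v : S (emb m) -> S (emb r) -> 
  0 < area r m -> 0 < area m v -> S (emb v) -> 0 < area r v.
Proof.
move=> /S_coord[_ _ Sm] /S_coord[_ _ Sr] rm mv /S_coord[_ _ Sv].
rewrite -(pmulr_rgt0 _ Sm) (_ : _ * _ =
  (a r + b r) * area m v + (a v + b v) * area r m); last by rewrite /area; ring.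
by rewrite addr_gt0 ?mulr_gt0.
Qed.

Lemma later_short_coord r l v : oriented_basis O r l -> later_short S O M r v ->
  exists x y, v = r *~ x + l *~ y /\ 0 < y.
Proof.
move=> [bP /O_coord rl] [_ _ _ [_ _ /O_coord]]; have [[x y] [/= -> _]] := bP v.
rewrite areaDr !areaMzr areavv mul0r add0r pmulr_rgt0 // ltr0z => y0.
by exists x, y.
Qed.

(** A vector of positive norm outside S has both coordinates negative, hence a
negative product with every vector of S. *)
Lemma sum_spacelike r l : S (emb r) ->
  ~~ ((ratr (dot (r + l) (r + l)) <= M) || (dot (r + l) r < 0)) ->
  [/\ M < ratr (dot (r + l) (r + l)), 0 < a (r + l) & 0 < b (r + l)].
Proof.
move=> /S_coord[ra rb rs]; rewrite negb_or -ltNge -leNgt => /andP[mM].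
rewrite -(ler0q R) dot_coord => mr; move: (mM); rewrite norm_coord => ab.
have ab0 : 0 < a (r + l) * b (r + l) by exact: lt_trans M0 ab.
have am : 0 < a (r + l).
  rewrite ltNge; apply/negP => am.
  have {}am : a (r + l) < 0.
    by rewrite lt_neqAle am andbT; apply: contraTneq ab0 => ->; rewrite mul0r ltxx.
  have bm : b (r + l) < 0 by move: ab0; rewrite nmulr_rgt0.
  have h1 : a (r + l) * b r <= 0 by rewrite nmulr_rle0.
  have h2 : b (r + l) * a r <= 0 by rewrite nmulr_rle0.
  have [r0|r0] := ltP 0 (a r).
    have : b (r + l) * a r < 0 by rewrite nmulr_rlt0.
    by lra.
  have : a (r + l) * b r < 0 by rewrite nmulr_rlt0 //; lra.
  by lra.
by split=> //; move: ab0; rewrite pmulr_rgt0.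
Qed.

(** With v = (r + l) y + r (x - y), being not after r + l means y <= x; but then
v would be r + l plus a vector of the closed quadrant. *)
Lemma later_short_sum r l v : oriented_basis O r l -> S (emb r) ->
  ~~ ((ratr (dot (r + l) (r + l)) <= M) || (dot (r + l) r < 0)) ->
  later_short S O M r v -> later_short S O M (r + l) v.
Proof.
move=> bP Sr /(sum_spacelike Sr)[mM am bm] rv.
have [x [y [vE y0]]] := later_short_coord bP rv.
have [pv Sv vM _] := rv; have [? ? ?] := (S_coord r).1 Sr.
have [_ /O_coord rl] := bP.
split=> //; split=> //; first by apply/S_coord; split; lra.
have {}vE : v = (r + l) *~ y + r *~ (x - y).
  by rewrite vE mulrzDl mulrzBr [RHS]addrC addrA subrK.
apply/O_coord; have [xy|yx] := ltP x y.
  rewrite vE areaDr !areaMzr areavv mul0r add0r areaDl areavv add0r.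
  by rewrite area_swap mulNr -mulrN mulr_gt0 // oppr_gt0 ltrz0 subr_lt0.
suff : M < ratr (dot v v) by rewrite ltNge vM.
have -> : v = r + l + ((r + l) *~ (y - 1) + r *~ (x - y)).
  by rewrite {1}vE addrA (mulrzBr _ y 1) mulr1z [r + l + (_ - _)]addrC subrK.
by apply: norm_add_combination; rewrite ?subr_ge0 -?gtz0_ge1 // ltW.
Qed.

Lemma first_later_short_sum r l r' : oriented_basis O r l -> S (emb r) ->
  ~~ ((ratr (dot (r + l) (r + l)) <= M) || (dot (r + l) r < 0)) ->
  first_later_short S O M (r + l) r' -> first_later_short S O M r r'.
Proof.
move=> bP Sr st [[pr' Sr' r'M [Sm _ mr']] first]; split.
  split=> //; split=> //; apply/O_coord; apply: (precedes_trans Sm) => //.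
    by case: bP => _ /O_coord; rewrite areaDr areavv add0r.
  exact/O_coord.
by move=> v /(later_short_sum bP Sr st); exact: first.
Qed.

(** A vector r x + l y with y > 0 comes after l if x < 0, is a multiple of l if
x = 0, and is r + l plus a vector of the closed quadrant if x > 0. *)
Lemma first_later_short_supplement r l : supplement S O M r l -> S (emb r) ->
  ~~ ((ratr (dot (r + l) (r + l)) <= M) || (dot (r + l) r < 0)) ->
  0 <= dot l l -> 0 < dot r l ->
  first_later_short S O M r l /\ supplement S O M l (- r).
Proof.
move=> [bP lP] Sr /(sum_spacelike Sr)[mM am bm].
rewrite -(ler0q R) -(ltr0q R) norm_coord dot_coord => ll rl.
have [ra rb rs] := (S_coord r).1 Sr; have [zP /O_coord arl] := bP.
have [la lb] : 0 <= a l /\ 0 <= b l by split; nra.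
have Sl : S (emb l) by apply/S_coord; split=> //; nra.
have lM : ratr (dot l l) <= M by rewrite leNgt; apply/negP => lM; exact: lP.
have bR := oriented_basis_rot bP.
split; last first.
  split=> //; rewrite S_coord !raddfN /= => -[[? ? ?] _].
  lra.
split=> [|v rv].
  by split=> //; [exact: zbasis_primitive bR.1 | split=> //; exact/O_coord].
have [x [y [vE y0]]] := later_short_coord bP rv.
have [pv Sv vM _] := rv.
have [x0|x0|x0] := ltrgtP x 0.
- right; split=> //; apply/O_coord.
  rewrite vE areaDr !areaMzr areavv mul0r addr0 area_swap mulNr -mulrN.
  by rewrite mulr_gt0 // oppr_gt0 ltrz0.
- suff : M < ratr (dot v v) by rewrite ltNge vM.
  have -> : v = r + l + (r *~ (x - 1) + l *~ (y - 1)).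
    by rewrite vE !mulrzBr !mulr1z addrACA ![_ + (_ - _)]addrC !subrK.
  by apply: norm_add_combination; rewrite ?subr_ge0 -?gtz0_ge1 // ltW.
left; move: pv; rewrite vE x0 mulr0z add0r => /(primitive_multiple _ y0) ->.
  by rewrite mulr1z.
move=> n ln; have := areaMzr r l n; rewrite ln.
rewrite /area !raddf0 !mulr0 subrr => /esym/eqP.
by rewrite mulf_eq0 gt_eqF //= intr_eq0 => /eqP.
Qed.

(** Norms along l + k r are unbounded, even if r is lightlike, as long as r is
not on the last ray of S. *)
Lemma step_bound r l : S (emb r) -> 0 < a r -> 0 < area r l -> exists k : nat,
  let m := r + (l + r *+ k) in
  ~~ ((ratr (dot m m) <= M) || (dot m r < 0)).
Proof.
move=> /S_coord[_ rb _] ra rl.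
(* The norm of m is at least a m * (area r l / a r), so the condition is
   a m > M * a r / area r l. *)
pose q := (M * a r / area r l + `|a l|) / a r.
have q0 : 0 <= q by rewrite divr_ge0 ?addr_ge0 ?divr_ge0 ?mulr_ge0 // ltW.
exists (Num.bound q) => m.
have am : M * a r / area r l < a m.
  have := archi_boundP q0; rewrite /q ltr_pdivrMr // => h.
  rewrite /m !raddfD raddfMn /= -mulr_natr.
  have := ler_norm (- a l); rewrite normrN; lra.
have rm : a r * b m = b r * a m + area r l.
  by rewrite /m /area !raddfD !raddfMn /= -!(mulr_natr (null_coord _ _)); ring.
rewrite negb_or -ltNge -leNgt -(ler0q R) norm_coord dot_coord.
have am0 : 0 < a m by apply: le_lt_trans am; rewrite divr_ge0 ?mulr_ge0 // ltW.
have bm0 : 0 < b m by rewrite -(pmulr_rgt0 _ ra) rm; nra.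
apply/andP; split; last by rewrite divr_ge0 // addr_ge0 // mulr_ge0 // ltW.
move: am; rewrite ltr_pdivrMr // => am; rewrite -(ltr_pM2r ra).
apply: lt_le_trans am _; rewrite -mulrA [b m * _]mulrC rm; nra.
Qed.

Lemma supplement_sum r l : supplement S O M r l -> S (emb r) ->
  (ratr (dot (r + l) (r + l)) <= M) || (dot (r + l) r < 0) ->
  supplement S O M r (r + l).
Proof.
move=> [bP _] /S_coord[? ? ?] st; split; first exact: oriented_basis_addr.
move=> [/S_coord[? ? ?] mM]; case/orP: st; first by rewrite leNgt mM.
by rewrite -(ltrq0 R) dot_coord ltNge divr_ge0 // addr_ge0 // mulr_ge0.
Qed.

(** If x <= 0, then y l = v - x r is a sum of two vectors of the closed quadrant,
and l would be a vector of S not proportional to r. *)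
Lemma later_short_coef_gt0 r l v x y : S (emb r) -> oriented_basis O r l ->
  later_short S O M r v -> v = r *~ x + l *~ y ->
  ~~ ((0 <= dot l l) && (0 < dot r l)) -> 0 < x.
Proof.
move=> /S_coord[ra rb _] [_ /O_coord rl] [_ /S_coord[va vb _] _ [_ _ /O_coord rv]] vE.
have {rv} y0 : 0 < y.
  by move: rv; rewrite vE areaDr !areaMzr areavv mul0r add0r pmulr_rgt0 // ltr0z.
apply: contraR; rewrite -leNgt => x0.
move: va vb; rewrite vE !raddfD !raddfMz /= -!(mulrzr (null_coord _ _)).
have {}x0 : x%:~R <= 0 :> R by rewrite lerz0.
have {}y0 : 0 < y%:~R :> R by rewrite ltr0z.
move=> va vb; have la : 0 <= a l by nra.
have lb : 0 <= b l by nra.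
rewrite -(ler0q R) -(ltr0q R) norm_coord dot_coord mulr_ge0 //=.
rewrite /area in rl; nra.
Qed.

(** The outer induction is on a bound n of the coefficient y of a fixed short
vector, which decreases in step 4; the inner one, on a bound k of the number of
applications of step 2 that follow, which keep r and y. *)
Lemma promised_correct (n : nat) r l v x y : supplement S O M r l -> S (emb r) ->
  later_short S O M r v -> v = r *~ x + l *~ y -> y <= n%:Z ->
  exists fuel r' l', [/\ promised M fuel r l = Some (r', l'),
    first_later_short S O M r r' & supplement S O M r' l'].
Proof.
elim: n r l x y => [|n IH] r l x y.
  move=> [[bP /O_coord rl] _] Sr [_ _ _ [_ _ /O_coord rv]] vE; move: rv.
  rewrite vE areaDr !areaMzr areavv mul0r add0r pmulr_rgt0 // ltr0z; lia.
move=> sup Sr rv vE yn.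
have ra : 0 < a r.
  case: rv => _ /S_coord[? ? ?] _ [_ _ /O_coord]; case/S_coord: Sr => ? ? ?.
  rewrite /area; nra.
(* The situation where step 2 does not apply. *)
have stop l0 x0 : supplement S O M r l0 -> v = r *~ x0 + l0 *~ y ->
    ~~ ((ratr (dot (r + l0) (r + l0)) <= M) || (dot (r + l0) r < 0)) ->
    exists fuel r' l', [/\ promised M fuel r l0 = Some (r', l'),
      first_later_short S O M r r' & supplement S O M r' l'].
  move=> sup0 v0E st; have [bP lP] := sup0.
  have [l3|l3] := boolP ((0 <= dot l0 l0) && (0 < dot r l0)).
    have /andP[ll rl] := l3; exists 1%N, l0, (- r).
    have [? ?] := first_later_short_supplement sup0 Sr st ll rl.
    by split=> //=; rewrite (negPf st) l3.
  have x0_gt0 : 0 < x0 by exact: (later_short_coef_gt0 Sr bP rv v0E).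
  have mv := later_short_sum bP Sr st rv.
  have Sm : S (emb (r + l0)) by case: mv => _ _ _ [].
  have supm : supplement S O M (r + l0) l0.
    by split=> //; exact: oriented_basis_addl.
  have [| |f [r' [l' [fE r'P l'P]]]] := IH (r + l0) l0 x0 (y - x0) supm Sm mv.
  - by rewrite v0E mulrzDl mulrzBr [RHS]addrC addrCA subrK.
  - lia.
  exists f.+1, r', l'; split=> //=; first by rewrite (negPf st) (negPf l3).
  exact: first_later_short_sum r'P.
have [k] : exists k : nat, let m := r + (l + r *+ k) in
    ~~ ((ratr (dot m m) <= M) || (dot m r < 0)).
  by apply: step_bound => //; case: sup => -[_ /O_coord].
elim: k l x sup vE => [|k IHk] l x sup vE /=.
  by rewrite mulr0n addr0; exact: stop vE.
have [st|st _] := boolP ((ratr (dot (r + l) (r + l)) <= M) || (dot (r + l) r < 0));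
  last exact: stop vE st.
rewrite mulrS [l + (r + _)]addrCA [r + (l + _)]addrA => st'.
have [|f [r' [l' [fE r'P l'P]]]] := IHk (r + l) (x - y) (supplement_sum sup Sr st) _ st'.
  by rewrite vE mulrzBr mulrzDl addrA subrK.
by exists f.+1, r', l'; split=> //=; rewrite st.
Qed.

End Algorithm.


Theorem mainTheorem4 (R : realType) (L : lorentzianLattice R)
    (S : set (plane L)) (O : set (plane L * plane L)) (M : R) (r l : L) :
  is_nonneg_component S ->
  is_orientation O ->
  0 < M ->
  primitive r ->
  S (emb r) ->
  ~ Omega S O (emb r) ->
  supplement S O M r l ->
  (exists v : L, later_short S O M r v) ->
  exists fuel r' l',
    [/\ promised M fuel r l = Some (r', l'),
        first_later_short S O M r r' &
        supplement S O M r' l'].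
Proof.
move=> SP OP M0 _ Sr _ sup [v rv].
have [u [w coords]] := null_coordinates_exist SP OP.
have [x [y [vE y0]]] := later_short_coord coords sup.1 rv.
apply: (promised_correct coords M0 sup Sr rv vE (n := `|y|%N)).
by rewrite gez0_abs // ltW.
Qed.
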